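(* Let $\mathbf R,\mathbf S>0$, $v>0$ and $\beta^0,\rho^0\in[0,1]$ with $\beta^0+\rho^0=1$, and suppose that $$\beta^0\mathbf R-\rho^0\mathbf S>0 .$$ Let $(\overline{\mathfrak C}(t))_{t\ge0}$ be the linearized mean field cooperator wealth process. Then for every fixed $q_0>0$, $$\overline{\mathfrak C}(t)\longrightarrow+\infty\ \text{ as } t\to+\infty,\qquad \mathbb P_{q_0}\text{-almost surely},$$ and $$\mathbb P_{q_0}\big(\forall t\ge0,\ \overline{\mathfrak C}(t)>0\big)>0 .$$
   Context: The linearized mean field cooperator wealth process $(\overline{\mathfrak C}(t))_{t\ge0}$ is the real-valued pure jump process which, under $\mathbb P_{q_0}$, starts from $\overline{\mathfrak C}(0)=q_0$, is constant between consecutive times of $(t_n)_{n\ge1}$, where $(t_n)_{n\ge 1}$ are the jump times of a Poisson process of intensity $v/2$, and satisfies, at the $n$-th time, $\overline{\mathfrak C}(t_n)-\overline{\mathfrak C}(t_{n-1})=\overline U(n)$ (with $t_0=0$), where $(\overline U(n))_{n\ge1}$ are i.i.d., independent of the Poisson process, with $\overline U(n)=-\mathbf S$ with probability $\rho^0$ and $\overline U(n)=\mathbf R$ with probability $\beta^0$. *)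

(* Defs.v *)
From HB Require Import structures.
From mathcomp Require Import all_boot all_order all_algebra.
From mathcomp Require Import all_classical all_reals all_analysis.

Set Implicit Arguments.
Unset Strict Implicit.
Unset Printing Implicit Defensive.

Import Order.TTheory GRing.Theory Num.Theory.
Import numFieldNormedType.Exports.

Local Open Scope classical_set_scope.
Local Open Scope ring_scope.

Definition mutually_independent (R : realType) (d : measure_display)
    (T : measurableType d) (P : probability T R) (d' : measure_display)
    (T' : measurableType d') (X : nat -> T -> T') : Prop :=
  forall (J : seq nat) (B : nat -> set T'), uniq J ->
    (forall i, measurable (B i)) ->
    P (\bigcap_(i in [set` J]) (X i @^-1` B i)) =
    (\prod_(i <- J) P (X i @^-1` B i))%E.

Definition generated_sigma (d : measure_display) (T : measurableType d)
    (d' : measure_display) (T' : measurableType d') (I : Type) (D : set I)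
    (X : I -> T -> T') : set_system T :=
  <<s \bigcup_(i in D) preimage_set_system setT (X i) measurable >>.

Definition independent_systems (R : realType) (d : measure_display)
    (T : measurableType d) (P : probability T R) (G H : set_system T) : Prop :=
  forall A B, G A -> H B -> P (A `&` B) = (P A * P B)%E.

Record poisson_process (R : realType) (d : measure_display)
    (T : measurableType d) (P : probability T R) (lambda : R)
    (N : R -> {RV P >-> nat}) : Prop := PoissonProcess {
  poisson_process0 : forall w, N 0 w = 0%N ;
  poisson_process_nondecreasing :
    forall (s t : R) w, 0 <= s -> s <= t -> (N s w <= N t w)%N ;
  poisson_process_law : forall (s t : R) (k : nat), 0 <= s -> s < t ->
    P [set w | (N t w - N s w)%N = k] =
    (poisson_pmf (lambda * (t - s)) k)%:E ;
  poisson_process_independent : forall s : nat -> R, 0 <= s 0%N ->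
    (forall k, s k <= s k.+1) ->
    mutually_independent P (fun k w => (N (s k.+1) w - N (s k) w)%N) }.

(* The paths of N are the right-continuous unit-jump step functions that jump
   exactly at t 1 < t 2 < ...; t 0 = 0 is not a jump time. Since N takes finite
   values at every s >= 0, the t n are unbounded. *)
Definition jump_times (R : realType) (T : Type) (N : R -> T -> nat)
    (t : nat -> T -> R) : Prop :=
  forall w, [/\ t 0%N w = 0,
    forall n, t n w < t n.+1 w &
    forall n s, t n w <= s < t n.+1 w -> N s w = n].

(* U is indexed from 0: U n is the increment at the (n+1)-th jump time. *)
Definition linearized_wealth (R : realType) (gain loss v beta0 rho0 : R)
    (d : measure_display) (T : measurableType d) (P : probability T R) (q0 : R)
    (C : R -> T -> R) : Prop :=
  exists (N : R -> {RV P >-> nat}) (t : nat -> T -> R) (U : nat -> {RV P >-> R}),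
    [/\ poisson_process (v / 2) N,
        jump_times (fun s => N s : T -> nat) t,
        [/\ forall n, P [set w | U n w = - loss] = rho0%:E,
            forall n, P [set w | U n w = gain] = beta0%:E,
            mutually_independent P (fun n => U n : T -> R) &
            independent_systems P
              (generated_sigma setT (fun n => U n : T -> R))
              (generated_sigma [set s : R | 0 <= s]
                 (fun s => N s : T -> nat))] &
        forall w, [/\ C 0 w = q0,
          forall n s, t n w <= s < t n.+1 w -> C s w = C (t n w) w &
          forall n, C (t n.+1 w) w - C (t n w) w = U n w]].

(* Main.v *)
(** Only the embedded random walk matters: since the Poisson path takes finite
    values, the jump times are unbounded, so [C] tends to infinity (resp. stays
    positive) iff the walk [q0 + U 0 + ... + U (n-1)] does. The drift being
    positive, some exponential moment [r = E (exp (- theta U))] with [theta > 0]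
    is smaller than 1, whence the Chernoff bound
    [P (U 0 + ... + U (n-1) <= c) <= exp (theta c) r ^ n]. It is summable, and
    Borel-Cantelli gives the almost sure divergence. For survival, force the
    first [k] steps to be gains: conditionally on this, ruin has probability at
    most [exp (- theta (q0 + k gain)) / (1 - r)], which is smaller than 1 for
    large [k]. *)
Require Import Defs.
From HB Require Import structures.
From mathcomp Require Import all_boot all_order all_algebra.
From mathcomp Require Import all_classical all_reals all_analysis.
From mathcomp Require Import ring lra.

Set Implicit Arguments.
Unset Strict Implicit.
Unset Printing Implicit Defensive.

Import Order.TTheory GRing.Theory Num.Theory.
Import numFieldNormedType.Exports.

Local Open Scope classical_set_scope.
Local Open Scope ring_scope.

Lemma nneseries_geometric_le (R : realType) (a r : R) : 0 <= a -> 0 <= r < 1 ->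
  (\sum_(0 <= n <oo) (a * r ^+ n)%:E <= (a / (1 - r))%:E)%E.
Proof.
move=> a0 /andP[r0 r1]; have nr1 : `|r| < 1 by rewrite ger0_norm.
have cvs := @cvg_geometric_series R a r nr1.
rewrite (_ : limn _ = limn (EFin \o series (geometric a r))); last first.
  by congr (limn _); apply/funext => n /=; rewrite sumEFin.
by rewrite EFin_lim ?(cvg_lim _ cvs) //; apply/cvg_ex; exists (a / (1 - r)).
Qed.

(** * Random walk with independent two-valued steps *)

Section two_valued_walk.
Context (R : realType) (d : measure_display) (T : measurableType d)
  (P : probability T R) (U : nat -> {RV P >-> R}) (x p : bool -> R).

Definition walk (n : nat) (w : T) : R := \sum_(i < n) U i w.

Definition cylinder (s : seq bool) : set T :=
  [set w | forall i, (i < size s)%N -> U i w = x (nth true s i)].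

(** The Laplace transform [E (exp (- theta U))] of one step, written through the law [p] so that no
    integral has to be computed. *)
Definition laplace (theta : R) : R :=
  p true * expR (- theta * x true) + p false * expR (- theta * x false).

Lemma measurable_walk_le n c : measurable [set w | walk n w <= c].
Proof.
have mw : measurable_fun setT (walk n).
  by apply: measurable_sum => i; exact: measurable_funPT.
have := mw measurableT _ (measurable_itv `]-oo, c]).
by rewrite setTI.
Qed.

Lemma measurable_step_eq i a : measurable [set w | U i w = a].
Proof. exact: (measurable_funPTI (U i) (measurable_set1 a)). Qed.

(** Puts the event in the form to which [mutually_independent] applies. *)
Lemma cylinderE s : cylinder s =
  \bigcap_(i in [set` iota 0 (size s)]) (U i @^-1` [set x (nth true s i)]).
Proof.
apply/seteqP; split => w /= sw i.
  by rewrite /= mem_iota add0n => /andP[_]; exact: sw.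
by move=> si; apply: sw; rewrite /= mem_iota add0n.
Qed.

Lemma measurable_cylinder s : measurable (cylinder s).
Proof.
by rewrite cylinderE; exact: fin_bigcap_measurable.
Qed.

Lemma walk_cylinder s w n : cylinder s w -> (n <= size s)%N ->
  walk n w = \sum_(b <- take n s) x b.
Proof.
move=> sw ns; rewrite (big_nth true) size_take_min (minn_idPl ns) big_mkord.
by apply: eq_bigr => i _; rewrite nth_take ?sw // (leq_trans _ ns).
Qed.

Lemma cylinder_rcons s b w : cylinder s w -> U (size s) w = x b ->
  cylinder (rcons s b) w.
Proof.
move=> sw Ub i; rewrite size_rcons ltnS leq_eqVlt nth_rcons.
by case/predU1P => [->|si]; [rewrite ltnn eqxx | rewrite si sw].
Qed.

Hypothesis x_neq : x true != x false.
Hypothesis p_sum : p true + p false = 1.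
Hypothesis U_law : forall n b, P [set w | U n w = x b] = (p b)%:E.
Hypothesis U_indep : mutually_independent P (fun n => U n : T -> R).

Lemma law_ge0 b : 0 <= p b.
Proof. by rewrite -lee_fin -(U_law 0 b) measure_ge0. Qed.

Lemma laplace_ge0 theta : 0 <= laplace theta.
Proof. by rewrite addr_ge0 // mulr_ge0 ?law_ge0 ?expR_ge0. Qed.

Lemma P_cylinder s : P (cylinder s) = (\prod_(b <- s) p b)%:E.
Proof.
rewrite cylinderE (@U_indep _ (fun i => [set x (nth true s i)]) (iota_uniq _ _))//.
rewrite (big_nth true) /index_iota subn0 -prodEFin.
by apply: eq_bigr => i _; exact: U_law.
Qed.

(** The two values are distinct and their probabilities add up to 1, so a step can take another
    value only on a null set. *)
Lemma P_other_values n :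
  P (~` ([set w | U n w = x true] `|` [set w | U n w = x false])) = 0%E.
Proof.
have m b := measurable_step_eq n (x b).
rewrite probability_setC; last exact: measurableU.
have -> : P ([set w | U n w = x true] `|` [set w | U n w = x false]) = 1%E.
  rewrite -p_sum EFinD -!(U_law n); apply: measureU => //.
  apply/seteqP; split => // w [/= ut uf].
  by move: x_neq; rewrite -ut -uf eqxx.
by rewrite subee.
Qed.

(* Chernoff's bound started from a prescribed initial segment, by induction on
   the number [m] of remaining steps, conditioning on the next step. *)
Lemma chernoff_cylinder theta c m s : 0 <= theta ->
  (P (cylinder s `&` [set w | (walk (size s + m)%N w <= c)%R]) <=
   ((\prod_(b <- s) p b) *
    (expR (theta * (c - \sum_(b <- s) x b)) * laplace theta ^+ m))%:E)%E.
Proof.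
move=> theta0; elim: m s => [|m IHm] s.
  rewrite addn0 expr0 mulr1.
  have p0 : 0 <= \prod_(b <- s) p b by apply: prodr_ge0 => b _; exact: law_ge0.
  (* With no step left the walk is deterministic on the cylinder: either the exponential factor is
     at least 1, or the event is empty. *)
  have [le_c|gt_c] := lerP (\sum_(b <- s) x b) c.
    apply: (@le_trans _ _ (P (cylinder s))).
      apply: le_measure; rewrite ?inE; last exact: subIsetl.
        apply: measurableI; [exact: measurable_cylinder |].
        exact: measurable_walk_le.
      exact: measurable_cylinder.
    rewrite P_cylinder lee_fin ler_peMr // -expR0 ler_expR.
    by rewrite mulr_ge0 // subr_ge0.
  rewrite (_ : _ `&` _ = set0) ?measure0 ?lee_fin ?mulr_ge0 ?expR_ge0 //.
  apply/seteqP; split => // w [sw] /=.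
  by rewrite (walk_cylinder sw) // take_size leNgt gt_c.
set D := [set w | _].
pose E b := cylinder (rcons s b) `&` D.
have mD : measurable D by exact: measurable_walk_le.
have mE b : measurable (E b).
  by apply: measurableI => //; exact: measurable_cylinder.
(* The null event on which the next step takes neither value. *)
set Z := ~` ([set w | U (size s) w = x true] `|`
             [set w | U (size s) w = x false]).
have mZ : measurable Z.
  by apply/measurableC/measurableU; exact: measurable_step_eq.
have sub : cylinder s `&` D `<=` (E true `|` E false) `|` Z.
  move=> w [sw Dw]; have [ut|ut] := pselect (U (size s) w = x true).
    by left; left; split => //; exact: cylinder_rcons.
  have [uf|uf] := pselect (U (size s) w = x false).
    by left; right; split => //; exact: cylinder_rcons.
  by right => -[].
have bE b : (P (E b) <= ((\prod_(b <- s) p b * p b) *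
    (expR (theta * (c - (\sum_(b <- s) x b + x b))) * laplace theta ^+ m))%:E)%E.
  have := IHm (rcons s b); rewrite size_rcons addSnnS -/D -/(E b).
  by rewrite !big_rcons.
have mEE : measurable (E true `|` E false) by exact: measurableU.
apply: (@le_trans _ _ (P ((E true `|` E false) `|` Z))).
  apply: le_measure => //; rewrite ?inE; last exact: measurableU.
  by apply: measurableI => //; exact: measurable_cylinder.
rewrite measureU0 //; last exact: P_other_values.
apply: (le_trans (measureU2 _ (mE _) (mE _))).
apply: (le_trans (leeD (bE true) (bE false))).
rewrite -EFinD lee_fin exprS /laplace.
(* Factoring out the contribution of the next step lets the two branches add up to one more factor
   [laplace theta]. *)
have expE b : expR (theta * (c - (\sum_(b <- s) x b + x b))) =
    expR (theta * (c - \sum_(b <- s) x b)) * expR (- theta * x b).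
  by rewrite -expRD; congr expR; ring.
by rewrite !expE le_eqVlt; apply/orP; left; apply/eqP; ring.
Qed.

(** Union bound over all later times: the Chernoff bounds form a geometric series. *)
Lemma walk_le_cylinder_ever theta c s : 0 <= theta -> laplace theta < 1 ->
  (P (cylinder s `&` \bigcup_m [set w | (walk (size s + m)%N w <= c)%R]) <=
   ((\prod_(b <- s) p b) *
    (expR (theta * (c - \sum_(b <- s) x b)) / (1 - laplace theta)))%:E)%E.
Proof.
move=> theta0 r1.
have mF m : measurable (cylinder s `&` [set w | (walk (size s + m)%N w <= c)%R]).
  apply: measurableI; [exact: measurable_cylinder |].
  exact: measurable_walk_le.
rewrite setI_bigcupr mulrA; apply: le_trans.
  apply: measure_sigma_subadditive (@subset_refl _ _) => //.
  exact: bigcup_measurable.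
apply: le_trans (nneseries_geometric_le _ _); last first.
- by rewrite laplace_ge0.
- by rewrite mulr_ge0 ?expR_ge0 ?prodr_ge0 // => b _; exact: law_ge0.
apply: lee_nneseries => // n _.
by rewrite -mulrA; exact: chernoff_cylinder.
Qed.

Lemma walk_to_infinity theta : 0 <= theta -> laplace theta < 1 ->
  {ae P, forall w, forall M : nat, \forall n \near \oo, M%:R < walk n w}.
Proof.
move=> theta0 r1; apply: ae_foralln => M.
pose F n := [set w | walk n w <= M%:R].
have mF n : measurable (F n) by exact: measurable_walk_le.
(* Borel-Cantelli, with the Chernoff bound taken on the empty cylinder, which is the whole space. *)
have F0 : P (lim_sup_set F) = 0%E.
  apply: lim_sup_set_cvg0 => //.
  apply: le_lt_trans (ltry (expR (theta * M%:R) / (1 - laplace theta))).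
  apply: le_trans (nneseries_geometric_le _ _); last first.
  - by rewrite laplace_ge0.
  - exact: expR_ge0.
  apply: lee_nneseries => // n _.
  have := @chernoff_cylinder theta M%:R n [::] theta0.
  rewrite !big_nil mul1r subr0 add0n (_ : cylinder [::] = setT) ?setTI //.
  by apply/seteqP; split.
exists (lim_sup_set F); split => //.
  by apply: bigcapT_measurable => n; apply: bigcup_measurable.
move=> w /= notcv n _ /=; apply: contrapT => nF; apply: notcv.
exists n => // k /= nk; rewrite ltNge; apply/negP => Fk.
by apply: nF; exists k.
Qed.

Lemma walk_stays_above theta c : 0 < theta -> laplace theta < 1 ->
  0 < x true -> 0 < p true -> c < 0 ->
  (0 < P (\bigcap_n [set w | (c < walk n w)%R]))%E.
Proof.
move=> theta0 r1 xt0 pt0 c0.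
set G := \bigcap_n _.
have mG : measurable G.
  apply: bigcapT_measurable => n.
  rewrite (_ : [set w | _] = ~` [set w | walk n w <= c]).
    by apply: measurableC; exact: measurable_walk_le.
  by apply/seteqP; split => w /=; rewrite ltNge => /negP.
have [k small] : exists k : nat,
    expR (theta * (c - x true *+ k)) / (1 - laplace theta) < 1.
  have r0 : 0 < 1 - laplace theta by rewrite subr_gt0.
  (* This [y] solves [exp (- theta * x true * y) = 1 - laplace theta]; since [c < 0], any integer
     above it will do for [k]. *)
  pose y := - ln (1 - laplace theta) / (theta * x true).
  exists (Num.bound `|y|).
  rewrite ltr_pdivrMr // mul1r -[ltRHS]lnK ?posrE // ltr_expR.
  have : y < (Num.bound `|y|)%:R.
    by rewrite (le_lt_trans (ler_norm _)) // archi_boundP.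
  rewrite ltr_pdivrMr ?mulr_gt0 // -mulr_natr => h.
  have : theta * c < 0 by rewrite nmulr_llt0.
  nra.
have sumk n : \sum_(b <- nseq n true) x b = x true *+ n.
  by rewrite big_nseq iter_addr_0.
set s := nseq k true.
pose B := cylinder s `&` \bigcup_m [set w | (walk (size s + m)%N w <= c)%R].
have mB : measurable B.
  apply: measurableI; first exact: measurable_cylinder.
  by apply: bigcup_measurable => m _; exact: measurable_walk_le.
(* During the [k] initial gains the walk is nonnegative, hence above [c]; a later failure falls in
   [B]. *)
have sub : cylinder s `<=` G `|` B.
  move=> w sw; have [Bw|nBw] := pselect (B w); first by right.
  left => n _ /=; have [nk|kn] := leqP n (size s).
    rewrite (walk_cylinder sw) // take_nseq; last by rewrite -(size_nseq k true).
    by rewrite sumk (lt_le_trans c0) // mulrn_wge0 // ltW.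
  rewrite ltNge; apply/negP => wc; apply: nBw; split => //.
  by exists (n - size s)%N => //=; rewrite subnKC // ltnW.
have s_gt0 : 0 < \prod_(b <- s) p b.
  by rewrite big_nseq iter_mulr_1 exprn_gt0.
have PB : (P B < (\prod_(b <- s) p b)%:E)%E.
  apply: le_lt_trans (walk_le_cylinder_ever c s (ltW theta0) r1) _.
  by rewrite lte_fin sumk gtr_pMr.
(* If [G] were null, the cylinder would be at most as likely as [B], against [PB]. *)
rewrite lt0e measure_ge0 andbT; apply/eqP => G0.
have : (P (cylinder s) <= P (G `|` B))%E.
  apply: le_measure => //; rewrite inE; last exact: measurableU.
  exact: measurable_cylinder.
by rewrite setUC measureU0 // P_cylinder leNgt PB.
Qed.

End two_valued_walk.

(* Uses [expR y <= (1 - y)^-1] for both terms. *)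
Lemma laplace_lt1 (R : realType) (gain loss beta rho : R) :
  0 < gain -> 0 < loss -> 0 <= beta -> 0 <= rho -> beta + rho = 1 ->
  0 < beta * gain - rho * loss ->
  exists2 theta, 0 < theta &
    beta * expR (- theta * gain) + rho * expR (- theta * - loss) < 1.
Proof.
move=> g0 l0 b0 r0 br D0.
have expV (y : R) : y < 1 -> expR y <= (1 - y)^-1.
  move=> y1; rewrite -[expR y]invrK -expRN lef_pV2 ?posrE ?expR_gt0 ?subr_gt0 //.
  exact: expR_ge1Dx.
(* Once denominators are cleared, the final inequality reads [theta * gain * loss < beta * gain -
   rho * loss]; [theta] is half the critical value. *)
pose theta := (beta * gain - rho * loss) / (2 * gain * loss).
have gl0 : 0 < 2 * gain * loss by rewrite !mulr_gt0.
have theta0 : 0 < theta by rewrite divr_gt0.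
have thetaE : theta * (2 * gain * loss) = beta * gain - rho * loss.
  by rewrite divfK // gt_eqF.
clearbody theta.
have tl1 : theta * loss < 1 by nra.
have tg0 : 0 < theta * gain by rewrite mulr_gt0.
exists theta => //.
apply: (@le_lt_trans _ _
    (beta / (1 + theta * gain) + rho / (1 - theta * loss))).
  apply: lerD; apply: ler_wpM2l => //.
    by have := expV (- theta * gain); rewrite mulNr opprK; apply; lra.
  by have := expV (- theta * - loss); rewrite mulrNN; apply.
have p1 : 0 < 1 + theta * gain by lra.
have p2 : 0 < 1 - theta * loss by lra.
rewrite addf_div ?gt_eqF // ltr_pdivrMr ?mulr_gt0 // mul1r.
have := mulr_gt0 theta0 (mulr_gt0 theta0 (mulr_gt0 g0 l0)).
have -> : rho = 1 - beta by lra.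
have : theta * (theta * (2 * gain * loss)) = theta * (beta * gain - rho * loss).
  by rewrite thetaE.
nra.
Qed.

(** * Jump times of a counting path *)

Section jump_times_paths.
Context (R : realType) (T : Type) (N : R -> T -> nat) (t : nat -> T -> R).
Hypothesis N_mono : forall (s s' : R) w, 0 <= s -> s <= s' -> (N s w <= N s' w)%N.
Hypothesis tN : jump_times N t.

Lemma jump_times_le m n w : (m <= n)%N -> t m w <= t n w.
Proof.
have [_ tS _] := tN w.
by move=> /(homo_leq lexx le_trans (fun k => ltW (tS k))).
Qed.

Lemma jump_times_locate s w : 0 <= s -> exists n, t n w <= s < t n.+1 w.
Proof.
move=> s0; have [t0 tS tI] := tN w.
have ex : exists m, s < t m w.
  apply: contrapT => /forallNP no.
  (* If no jump time exceeded [s], then at time [t m w <= s] the path would already equal [m], more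
     than [N s w]. *)
  pose m := (N s w).+1.
  have tm : t m w <= s by rewrite leNgt; apply/negP/no.
  have := N_mono w _ tm.
  rewrite (tI m) ?ltnn ?lexx ?tS //.
  by rewrite -t0 jump_times_le // => /(_ isT).
case: (ex_minnP ex) => -[|n] sn min; first by move: sn; rewrite t0 ltNge s0.
exists n; rewrite sn andbT leNgt; apply/negP => /min.
by rewrite ltnn.
Qed.

End jump_times_paths.

(** * Transfer from the walk to the wealth process *)

Theorem theorem1p1 (R : realType) (gain loss v beta0 rho0 : R)
  (gain_gt0 : 0 < gain) (loss_gt0 : 0 < loss) (v_gt0 : 0 < v)
  (beta0_01 : 0 <= beta0 <= 1) (rho0_01 : 0 <= rho0 <= 1)
  (beta0_rho0 : beta0 + rho0 = 1)
  (drift_gt0 : 0 < beta0 * gain - rho0 * loss)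
  (q0 : R) (q0_gt0 : 0 < q0)
  (d : measure_display) (T : measurableType d) (P : probability T R)
  (C : R -> T -> R) (HC : linearized_wealth gain loss v beta0 rho0 P q0 C) :
  {ae P, forall w, C t w @[t --> +oo] --> +oo} /\
  (0 < P [set w | forall t : R, (0 <= t -> 0 < C t w)%R])%E.
Proof.
have [N [t [U [HN tN [Uloss Ugain Uind _] CU]]]] := HC.
have locate := jump_times_locate (@poisson_process_nondecreasing _ _ _ _ _ _ HN) tN.
have [beta_ge0 _] := andP beta0_01; have [rho_ge0 _] := andP rho0_01.
have C_walk w n s : t n w <= s < t n.+1 w -> C s w = q0 + walk U n w.
  have [C0 Cstep Cjump] := CU w; have [t0 _ _] := tN w.
  move=> /Cstep ->; elim: n => [|n IHn]; first by rewrite t0 C0 /walk big_ord0 addr0.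
  rewrite -[LHS](subrK (C (t n w) w)) Cjump IHn /walk big_ord_recr /=.
  by rewrite addrCA [U n w + _]addrC.
pose x b := if b then gain else - loss.
pose p b := if b then beta0 else rho0.
have x_neq : x true != x false by rewrite gt_eqF //= (lt_trans _ gain_gt0) // oppr_lt0.
have U_law n b : P [set w | U n w = x b] = (p b)%:E by case: b.
have [theta theta_gt0 lap_lt1] : exists2 theta, 0 < theta & laplace x p theta < 1.
  exact: laplace_lt1.
split.
  have := walk_to_infinity x_neq beta0_rho0 U_law Uind (ltW theta_gt0) lap_lt1.
  apply: filterS => w walk_oo.
  apply/cvgryPge => A.
  have [n0 _ n0P] := walk_oo (Num.bound `|A - q0|).
  near=> s.
  have s_ge : t n0 w <= s by near: s; apply: nbhs_pinfty_ge; exact: num_real.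
  have t0s : 0 <= s.
    have [<- _ _] := tN w.
    exact: le_trans (jump_times_le tN w (leq0n n0)) s_ge.
  have [n /[dup] /C_walk -> /andP[_ s_lt]] := locate s w t0s.
  (* Past the jump time [t n0 w], the index of the current interval is at least [n0]. *)
  have n0n : (n0 <= n)%N.
    rewrite leqNgt; apply/negP => nn0.
    have := jump_times_le tN w nn0.
    by rewrite leNgt (le_lt_trans s_ge).
  rewrite -lerBlDl (le_trans (ler_norm _)) //.
  by rewrite (le_trans (ltW (archi_boundP _))) // ltW // n0P.
(* The wealth takes exactly the values [q0 + walk U n w], each one at time [t n w]. *)
rewrite (_ : [set w | _] = \bigcap_n [set w | - q0 < walk U n w]).
  apply: (walk_stays_above x_neq beta0_rho0 U_law Uind theta_gt0 lap_lt1) => //.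
    (* A zero [beta0] would make the drift nonpositive. *)
    by rewrite /p; nra.
  by rewrite oppr_lt0.
apply/seteqP; split => w /= Cpos n.
  move=> _; rewrite /= -subr_gt0 opprK addrC -(C_walk w n (t n w)).
    apply: Cpos; have [<- _ _] := tN w.
    exact: (jump_times_le tN w (leq0n n)).
  by have [_ tS _] := tN w; rewrite lexx tS.
move=> n_ge0; have [k /C_walk ->] := locate n w n_ge0.
by rewrite -ltrBlDl sub0r; exact: Cpos.
Unshelve. all: by end_near. Qed.
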